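(* Let $Y$ be a real topological vector space, $F\subseteq Y$, $a\in Y$, let $H$ be a proper closed subset of $Y$ and $k\in 0^+H\setminus\{0\}$. Assume that $F$ is a compact set and that the problem $(P_{F,a,H,k})$ has a feasible solution. Then $M_{F,a,H,k}$ is nonempty and compact under each of the following conditions: (a) $F\cap(a-H)=\emptyset$, (b) $F\cap(a-\operatorname{int}H)=\emptyset$ and $H+\mathbb{R}_{>}k\subset\operatorname{int}H$, (c) $H$ does not contain a line in direction $k$, (d) $H$ is convex and $k\notin-0^+H$.
   Context: For $A\subseteq Y$, the recession cone is $0^+A:=\{u\in Y\mid A+\mathbb{R}_+u\subseteq A\}$, where $\mathbb{R}_+=[0,\infty)$; $\mathbb{R}_>=(0,\infty)$. A proper subset of $Y$ is a nonempty subset different from $Y$. $\operatorname{int}$ is the topological interior. $H$ contains a line in direction $k$ if $x+\mathbb{R}k\subseteq H$ for some $x$. $(P_{F,a,H,k})$ is the problem of minimizing $t$ over all pairs $(y,t)\in F\times\mathbb{R}$ with $y\in a-H+tk$ (the feasible solutions). $M_{F,a,H,k}$ is the set of its optimal solutions $y$, i.e. of all $y\in F$ for which there is $t\in\mathbb{R}$ such that $(y,t)$ is feasible and $t\le s$ for every feasible $(z,s)$. *)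

(* Defs.v *)
From HB Require Import structures.
From mathcomp Require Import all_boot all_order all_algebra.
From mathcomp Require Import all_classical all_reals.
From mathcomp Require Import convex topology normedtype.

Set Implicit Arguments.
Unset Strict Implicit.
Unset Printing Implicit Defensive.

Import Order.TTheory GRing.Theory Num.Theory.
Import numFieldTopology.Exports numFieldNormedType.Exports.

Local Open Scope classical_set_scope.
Local Open Scope ring_scope.

Definition proper_subset (T : Type) (A : set T) : Prop :=
  A !=set0 /\ A <> setT.

Definition recession_cone (R : realType) (Y : lmodType R) (A : set Y) : set Y :=
  [set u | [set x + r *: u | x in A & r in [set r : R | 0 <= r]] `<=` A].

Definition contains_line (R : realType) (Y : lmodType R) (A : set Y) (k : Y) :
    Prop :=
  exists x : Y, [set x + r *: k | r in [set: R]] `<=` A.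

Definition feasible_pairs (R : realType) (Y : lmodType R)
    (F : set Y) (a : Y) (H : set Y) (k : Y) : set (Y * R) :=
  [set p | F p.1 /\ [set a - h + p.2 *: k | h in H] p.1].

(* Only the Y-components of the optimal pairs are collected. *)
Definition optimal_points (R : realType) (Y : lmodType R)
    (F : set Y) (a : Y) (H : set Y) (k : Y) : set Y :=
  [set y | F y /\ exists t : R, feasible_pairs F a H k (y, t) /\
     forall (z : Y) (s : R), feasible_pairs F a H k (z, s) -> t <= s].

(* Main.v *)
(* The pair [(y, t)] is feasible iff [y] lies in [F] and in the closed set
   [C t] of all [y] with [a - y + t k] in [H]. Since [k] is a recession
   direction of [H], the sets [C t] increase with [t], so by compactness of [F]
   the infimum of the feasible values is attained unless it is [-oo]. In the
   latter case a point of [F] belongs to every [C t], i.e. [H] contains the line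
   [a - y + R k], which each of the four conditions excludes. *)
Require Import Defs.
From HB Require Import structures.
From mathcomp Require Import all_boot all_order all_algebra.
From mathcomp Require Import interval_inference.
From mathcomp Require Import all_classical all_reals.
From mathcomp Require Import convex topology normedtype.

Set Implicit Arguments.
Unset Strict Implicit.
Unset Printing Implicit Defensive.

Import Order.TTheory GRing.Theory Num.Theory.
Import numFieldTopology.Exports numFieldNormedType.Exports.

Local Open Scope classical_set_scope.
Local Open Scope ring_scope.

(** The nested, nonempty traces of the [C t] on [F] form a filter base; compactness gives a cluster
    point in [F], and closedness puts it in every [C t]. The index set [D] is a parameter since both
    the whole line and an open half-line occur below. *)
Lemma compact_chain_meet (T : topologicalType) (d : Order.disp_t)
    (I : orderType d) (D : set I) (F : set T) (C : I -> set T) :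
  compact F -> D !=set0 -> (forall t, D t -> closed (C t)) ->
  {homo C : s t / (s <= t)%O >-> s `<=` t} ->
  (forall t, D t -> F `&` C t !=set0) ->
  exists2 y, F y & forall t, D t -> C t y.
Proof.
move=> Fco [t0 Dt0] Ccl Cmono CF.
have FF : Filter (filter_from D (fun t => F `&` C t)).
  apply: filter_from_filter => [|s t Ds Dt]; first by exists t0.
  have [st|ts] := leP s t.
    by exists s => // y [Fy Csy]; split; split=> //; exact: (Cmono _ _ st).
  by exists t => // y [Fy Cty]; split; split=> //; exact: (Cmono _ _ (ltW ts)).
have PF := filter_from_proper FF CF.
have [|y [Fy clFy]] := Fco _ PF.
  by exists t0 => // y [].
exists y => // t Dt; apply: (Ccl t Dt) => B By.
by apply: (clFy (C t) B _ By); exists t => // z [].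
Qed.

Lemma closed_affine_at_right (R : realType) (Y : topologicalLmodType R)
    (H : set Y) (y u : Y) (t0 : R) :
  closed H -> (\forall t \near t0^'+, H (y + t *: u)) -> H (y + t0 *: u).
Proof.
move=> Hcl Hnear; apply: (closed_cvg _ Hcl Hnear).
apply: cvg_at_right_filter.
have ctsZ : continuous (fun t : R^o => t *: u).
  move=> t; apply: (@continuous_comp _ (R^o * Y)%type _ (fun t : R^o => (t, u))
    (fun z => z.1 *: z.2)); last exact: scale_continuous.
  apply: (@cvg_pair _ _ _ _ (nbhs (t : R^o))); first exact: cvg_id.
  exact: cvg_cst.
apply: (@continuous_comp R^o (Y * Y)%type _ (fun t : R^o => (y, t *: u))
  (fun z => z.1 + z.2)); last exact: add_continuous.
by apply: cvg_pair; [exact: cvg_cst|exact: ctsZ].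
Qed.

(** This turns condition (d) into the absence of lines in direction [k]. *)
Lemma convex_closed_line_recession (R : realType) (Y : topologicalLmodType R)
    (H : set Y) (k : Y) :
  convex_set H -> closed H -> contains_line H k -> recession_cone H (- k).
Proof.
move=> Hcvx Hcl [p pH] _ [x Hx [r r0 <-]].
(* The points [(1 - t) x + t (p - (r / t) k)] tend to [x - r k] as [t -> 0+]. *)
suff : H (x - r *: k + 0 *: (p - x)) by rewrite scale0r addr0 scalerN.
apply: closed_affine_at_right => //; near=> t.
have t0 : 0 < t by near: t; exact: nbhs_right_gt.
have t1 : t <= 1 by near: t; exact: nbhs_right_ltW.
have Hq : H (p + (- (r / t)) *: k) by apply: pH; exists (- (r / t)).
have := Hcvx _ _ (Itv01 (ltW t0) t1) (mem_set Hq) (mem_set Hx).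
rewrite inE; congr H.
rewrite /conv/= /unstable.onem scalerDr scalerA mulrN mulrC divfK ?gt_eqF//.
rewrite scalerBl scale1r scalerBr scaleNr.
by rewrite addrACA [t *: p + x]addrC addrACA.
Unshelve. all: by end_near. Qed.

Lemma feasible_pairsE (R : realType) (Y : lmodType R) (F H : set Y) (a k y : Y)
    (t : R) :
  feasible_pairs F a H k (y, t) <-> F y /\ H (a - y + t *: k).
Proof.
split=> [[/= Fy [h Hh hy]]|[Fy Hy]]; split=> //=.
  by rewrite -hy opprD opprB addrA [a + _]addrC subrK subrK.
by exists (a - y + t *: k) => //; rewrite opprD opprB addrA subrKC subrK.
Qed.

Theorem proposition5 (R : realType) (Y : topologicalLmodType R)
    (F : set Y) (a : Y) (H : set Y) (k : Y)
    (H_proper : proper_subset H) (H_closed : closed H)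
    (k_rec : recession_cone H k) (k_neq0 : k <> 0)
    (F_compact : compact F)
    (feasible_ex : feasible_pairs F a H k !=set0) :
  [\/ F `&` [set a - h | h in H] = set0,
      F `&` [set a - h | h in interior H] = set0 /\
        [set h + r *: k | h in H & r in [set r : R | 0 < r]] `<=` interior H,
      ~ contains_line H k
    | convex_set H /\ ~ [set - u | u in recession_cone H] k] ->
  optimal_points F a H k !=set0 /\ compact (optimal_points F a H k).
Proof.
move=> conds; pose C t := [set y | H (a - y + t *: k)].
have HD h r : H h -> 0 <= r -> H (h + r *: k).
  by move=> Hh r0; apply: k_rec; exists h => //; exists r.
have Cmono : {homo C : s t / s <= t >-> s `<=` t}.
  move=> s t st y Csy; have := HD _ (t - s) Csy.
  by rewrite subr_ge0 -addrA -scalerDl subrKC; exact.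
have Ccl t : closed (C t).
  apply: (@preimage_closed _ _ (fun y => a - y + t *: k)) => // y _.
  apply: (@continuous_comp _ (Y * Y)%type _ (fun y => (a - y, t *: k))
    (fun z => z.1 + z.2)); last exact: add_continuous.
  apply: cvg_pair; last exact: cvg_cst.
  apply: (@continuous_comp _ (Y * Y)%type _ (fun y => (a, y))
    (fun z => z.1 - z.2)); last exact: sub_continuous.
  by apply: cvg_pair; [exact: cvg_cst|exact: cvg_id].
pose D := [set t | F `&` C t !=set0].
have D0 : D !=set0.
  by have [[y t] /feasible_pairsE yt] := feasible_ex; exists t, y.
have noline : F `&` \bigcap_t C t = set0.
  rewrite -subset0 => y [Fy Cy].
  have line : contains_line H k.
    by exists (a - y) => _ [t _ <-]; exact: Cy.
  case: conds => [/seteqP[+ _]|[/seteqP[+ _] Hint]|/(_ line)//|[Hcvx]].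
  - apply; split; first exact: Fy.
    exists (a - y); last by rewrite subKr.
    by have := Cy 0 I; rewrite /C/= scale0r addr0.
  - apply; split; first exact: Fy.
    exists (a - y); last by rewrite subKr.
    (* Stepping back by [k] stays on the line, hence in [H]; stepping forward again lands at
       [a - y], now in the interior. *)
    apply: Hint; exists (a - y + (- 1) *: k); first exact: Cy.
    by exists 1 => //=; rewrite scaleN1r scale1r subrK.
  - apply; exists (- k); last by rewrite opprK.
    exact: convex_closed_line_recession.
(* [D] is upward closed, so without a lower bound it would be all of [R], and some point of [F]
   would lie in every [C t], against [noline]. *)
have Dlb : has_lbound D.
  apply: contrapT => Dlb.
  have DT t : D t.
    apply: contrapT => nDt; apply: Dlb; exists t => s [y [Fy Csy]].
    rewrite leNgt; apply/negP => st; apply: nDt; exists y; split=> //.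
    exact: (Cmono _ _ (ltW st)).
  have [] := @compact_chain_meet _ _ R setT F C F_compact.
  - by exists 0.
  - by move=> t _; exact: Ccl.
  - exact: Cmono.
  - by move=> t _; exact: DT.
  by move=> y Fy Cy; rewrite -[False]/(set0 y) -noline; split=> // t _; exact: Cy.
have infD t : D t -> inf D <= t by exact: ge_inf.
have Dinf t : inf D < t -> D t.
  rewrite -subr_gt0 => /inf_adherent /(_ (conj D0 Dlb))[s [y [Fy Csy]]].
  by rewrite subrKC => /ltW st; exists y; split=> //; exact: (Cmono _ _ st).
(* An optimal value is a lower bound of [D], so it is at most [inf D] and monotonicity of [C]
   applies. Compactness is then immediate. *)
have optE : optimal_points F a H k = F `&` C (inf D).
  apply/seteqP; split=> y.
    move=> [Fy [t [/feasible_pairsE[_ Cty] tmin]]]; split=> //.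
    apply: (Cmono _ _ _ _ Cty); apply: lb_le_inf => // s [z zs].
    by apply: (tmin z); apply/feasible_pairsE.
  move=> [Fy Cy]; split=> //; exists (inf D); split; first exact/feasible_pairsE.
  by move=> z s /feasible_pairsE zs; apply: infD; exists z.
rewrite optE; split; last exact: compact_closedI.
(* Whether [inf D] belongs to [D] is still open, so only the values [t > inf D] are used; the common
   point reaches [C (inf D)] by letting [t] decrease to [inf D] in the closed set [H]. *)
have [] := @compact_chain_meet _ _ R [set t | inf D < t] F C F_compact.
- by exists (inf D + 1); rewrite /= ltrDl.
- by move=> t _; exact: Ccl.
- exact: Cmono.
- exact: Dinf.
move=> y Fy Cy; exists y; split=> //.
by apply: closed_affine_at_right => //; near=> t; apply: Cy; near: t;
  exact: nbhs_right_gt.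
Unshelve. all: by end_near. Qed.
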